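(* Let $(M,d)$ be a complete multiplicative metric space, let $\varphi:[1,\infty)\times[1,\infty)\to[1,\infty)$ be continuous with $\varphi(x,y)=1$ if and only if $x=y=1$, and let $T:M\to M$ be a function such that for all $u,v\in M$ $$d(Tu,Tv)\le \frac{\big(d(u,Tu)\cdot d(v,Tv)\big)^{\frac12}}{\varphi\big(d(u,Tu),d(v,Tv)\big)}.$$ Then $T$ has a unique fixed point in $M$.
   Context: A multiplicative metric on a nonempty set $X$ is a mapping $d:X\times X\to\mathbb{R}$ such that for all $x,y,z\in X$: $d(x,y)\ge 1$; $d(x,y)=1$ if and only if $x=y$; $d(x,y)=d(y,x)$; and $d(x,z)\le d(x,y)\cdot d(y,z)$. The pair $(X,d)$ is called a multiplicative metric space. A sequence $\{x_n\}$ in $X$ converges (multiplicatively) to $x\in X$ if for every $\epsilon>1$ there is a positive integer $n_0$ with $d(x_n,x)<\epsilon$ for all $n\ge n_0$. It is a multiplicative Cauchy sequence if for every $\epsilon>1$ there is a positive integer $n_0$ with $d(x_n,x_m)<\epsilon$ for all $n,m\ge n_0$. The space $(X,d)$ is complete if every multiplicative Cauchy sequence in $X$ converges (multiplicatively) to a point of $X$. *)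

(* Defs.v *)
From HB Require Import structures.
From mathcomp Require Import all_boot all_order all_algebra.
From mathcomp Require Import all_classical all_reals all_analysis.

Set Implicit Arguments.
Unset Strict Implicit.
Unset Printing Implicit Defensive.

Import Order.TTheory GRing.Theory Num.Theory.
Import numFieldNormedType.Exports.

Local Open Scope classical_set_scope.
Local Open Scope ring_scope.

Definition multiplicative_metric (R : realType) (X : Type) (d : X -> X -> R)
  : Prop :=
  [/\ forall x y, 1 <= d x y,
      forall x y, d x y = 1 <-> x = y,
      forall x y, d x y = d y x
    & forall x y z, d x z <= d x y * d y z].

Definition multiplicative_metric_space (R : realType) (X : Type)
    (d : X -> X -> R) : Prop :=
  [set: X] !=set0 /\ multiplicative_metric d.

Definition multiplicative_cvg (R : realType) (X : Type) (d : X -> X -> R)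
    (x_ : nat -> X) (x : X) : Prop :=
  forall eps : R, 1 < eps ->
    exists2 n0 : nat, (0 < n0)%N & forall n, (n0 <= n)%N -> d (x_ n) x < eps.

Definition multiplicative_cauchy (R : realType) (X : Type) (d : X -> X -> R)
    (x_ : nat -> X) : Prop :=
  forall eps : R, 1 < eps ->
    exists2 n0 : nat, (0 < n0)%N &
      forall n m, (n0 <= n)%N -> (n0 <= m)%N -> d (x_ n) (x_ m) < eps.

Definition multiplicative_complete (R : realType) (X : Type)
    (d : X -> X -> R) : Prop :=
  forall x_ : nat -> X, multiplicative_cauchy d x_ ->
    exists x : X, multiplicative_cvg d x_ x.

(* Main.v *)
Require Import Defs.
From HB Require Import structures.
From mathcomp Require Import all_boot all_order all_algebra.
From mathcomp Require Import all_classical all_reals all_analysis.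
From mathcomp Require Import lra.

Set Implicit Arguments.
Unset Strict Implicit.
Unset Printing Implicit Defensive.

Import Order.TTheory GRing.Theory Num.Theory.
Import numFieldNormedType.Exports.

Local Open Scope classical_set_scope.
Local Open Scope ring_scope.

(** With [a_n = d(T^n x, T^{n+1} x)] the contraction, squared, gives
    [a_{n+1} phi(a_n, a_{n+1}) <= a_n]; hence [a_n] decreases to some [a >= 1]
    with [a phi(a, a) <= a], which forces [a = 1].  Since moreover
    [d(Tu, Tv)^2 <= d(u, Tu) d(v, Tv)], the orbit is Cauchy, and its limit [x]
    satisfies [d(x, Tx) <= d(x, T^{n+1} x)^2 a_n -> 1]. *)

Section MultiplicativeContraction.
Variables (R : realType) (M : Type) (d : M -> M -> R).
Hypothesis d_metric : multiplicative_metric d.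

Let d_ge1 x y : 1 <= d x y. Proof. by case: d_metric. Qed.

(** Since [d] is at least 1, [|1 - d (x_ n) x|] is [d (x_ n) x - 1], so the multiplicative tolerance
    [1 + e] matches the additive tolerance [e]. This gives access to the limit theorems for real
    sequences. *)
Lemma multiplicative_cvg_dist (x_ : nat -> M) (x : M) :
  multiplicative_cvg d x_ x -> d (x_ n) x @[n --> \oo] --> (1 : R).
Proof.
move=> xx; apply/cvgrPdist_lt => e e0.
have [|n0 _ Hn] := xx (1 + e); first by rewrite ltrDl.
near=> n.
have n0n : (n0 <= n)%N by near: n; exact: nbhs_infty_ge.
have /= := Hn n n0n; have := d_ge1 (x_ n) x.
rewrite distrC ger0_norm ?subr_ge0// => *; lra.
Unshelve. all: by end_near. Qed.

Section FixedPoint.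
Variables (phi : R * R -> R) (T : M -> M).
Hypothesis phi_ge1 : forall x y : R, 1 <= x -> 1 <= y -> 1 <= phi (x, y).
Hypothesis phi_cont :
  {within [set p : R * R | 1 <= p.1 /\ 1 <= p.2], continuous phi}.
Hypothesis phi_eq1 : forall x y : R, 1 <= x -> 1 <= y ->
  (phi (x, y) = 1 <-> x = 1 /\ y = 1).
Hypothesis T_contr : forall u v : M,
  d (T u) (T v) <=
    ((d u (T u) * d v (T v)) `^ (1 / 2)) / phi (d u (T u), d v (T v)).

(** Multiplying by [phi > 0] and squaring turns the power 1/2, a square root, into a plain
    product. *)
Lemma contraction_sqr u v :
  (d (T u) (T v) * phi (d u (T u), d v (T v))) ^+ 2
  <= d u (T u) * d v (T v).
Proof.
have p0 : 0 < phi (d u (T u), d v (T v)).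
  by apply: lt_le_trans (phi_ge1 _ _).
have d0 x y : 0 <= d x y by apply: le_trans (d_ge1 _ _).
have := T_contr u v; rewrite ler_pdivlMr// div1r powR12_sqrt ?mulr_ge0// => h.
rewrite -[leRHS]sqr_sqrtr ?mulr_ge0// lerXn2r ?nnegrE ?sqrtr_ge0//.
by rewrite mulr_ge0// ltW.
Qed.

(** The factor [phi >= 1] is dropped; this weaker form serves for the Cauchy property, the limit and
    uniqueness. *)
Lemma contraction_sqr_le u v :
  d (T u) (T v) ^+ 2 <= d u (T u) * d v (T v).
Proof.
apply: le_trans (contraction_sqr u v).
have p1 := phi_ge1 (d_ge1 u (T u)) (d_ge1 v (T v)).
have d0 : 0 <= d (T u) (T v) by apply: le_trans (d_ge1 _ _).
have p0 : 0 <= phi (d u (T u), d v (T v)) by apply: le_trans p1.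
by rewrite lerXn2r ?nnegrE ?mulr_ge0// ler_peMr.
Qed.

Variable x0 : M.
Let x_ n := iter n T x0.
Let a_ n := d (x_ n) (x_ n.+1).

Lemma orbit_step n : a_ n.+1 * phi (a_ n, a_ n.+1) <= a_ n.
Proof.
have h := contraction_sqr (x_ n) (x_ n.+1).
rewrite -!/(x_ _.+1) -/(a_ n) -/(a_ n.+1) in h.
have a1 : 1 <= a_ n.+1 by exact: d_ge1.
have p1 : 1 <= phi (a_ n, a_ n.+1) by apply: phi_ge1; exact: d_ge1.
(* Cancelling one factor [a_ n.+1] leaves [a_ n.+1 * phi ^+ 2 <= a_ n], and [phi <= phi ^+ 2]
   because [phi >= 1]. *)
rewrite exprMn expr2 -mulrA [leRHS]mulrC in h.
rewrite ler_pM2l ?(lt_le_trans _ a1)// in h.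
apply: le_trans h; rewrite ler_wpM2l ?(le_trans _ a1)//.
by rewrite expr2 ler_peMr// (le_trans _ p1).
Qed.

Lemma orbit_step_cvg1 : a_ n @[n --> \oo] --> (1 : R).
Proof.
have a1 n : 1 <= a_ n by exact: d_ge1.
have cv : cvgn a_.
  apply: nonincreasing_is_cvgn; last by exists 1 => _ [n _ <-].
  apply/nonincreasing_seqP => n; apply: le_trans (orbit_step n).
  by rewrite ler_peMr ?phi_ge1// (le_trans _ (a1 _)).
have cvS : a_ n.+1 @[n --> \oo] --> limn a_ by rewrite (cvg_shiftS a_).
have l1 : 1 <= limn a_ by apply: limr_ge => //; exact: nearW.
have cvphi : phi (a_ n, a_ n.+1) @[n --> \oo] --> phi (limn a_, limn a_).
  move/subspace_continuousP: phi_cont => /(_ (limn a_, limn a_)) /=.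
  move=> /(_ (conj l1 l1)) pc.
  (* Continuity holds only within the quadrant, so neighbourhoods are relative to it; every pair
     [(a_ n, a_ n.+1)] lies there, as does the limit. *)
  apply: cvg_comp pc => B wB.
  have cv2 : (a_ n, a_ n.+1) @[n --> \oo] --> (limn a_, limn a_).
    exact: (cvg_pair cv cvS).
  apply: (@filterS _ \oo _ _ _ _ (cv2 _ wB)) => n Bn.
  exact: (Bn (conj (a1 _) (a1 _))).
have h : limn a_ * phi (limn a_, limn a_) <= limn a_.
  by apply: (ler_cvg_to (cvgM cvS cvphi) cv); apply: nearW; exact: orbit_step.
have [] := (phi_eq1 l1 l1).1; last by move=> e _; rewrite -[X in _ --> X]e.
(* Cancelling the positive limit in [h] gives [phi <= 1] at the limit pair. *)
apply/eqP; rewrite eq_le phi_ge1// andbT.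
by rewrite -(ler_pM2l (lt_le_trans ltr01 l1)) mulr1.
Qed.

Lemma orbit_cauchy : multiplicative_cauchy d x_.
Proof.
move=> e e1.
have [N _ HN] : \forall n \near \oo, a_ n < e.
  exact: (cvgr_lt (1 : R) orbit_step_cvg1).
(* The shift by one makes both points images under [T], so that [d (x_ n.+1) (x_ m.+1) ^+ 2 <= a_ n
   * a_ m < e ^+ 2]. *)
exists N.+1 => // -[//|n] [//|m]; rewrite !ltnS => Nn Nm.
have e0 : 0 < e by apply: lt_trans e1.
have d0 x y : 0 <= d x y by apply: le_trans (d_ge1 _ _).
rewrite -(@ltr_pXn2r _ 2) ?nnegrE ?(ltW e0)//.
apply: le_lt_trans (contraction_sqr_le _ _) _.
by rewrite expr2 ltr_pM//; [exact: HN | exact: HN].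
Qed.

Lemma orbit_limit_fixed x : multiplicative_cvg d x_ x -> T x = x.
Proof.
have [_ deq dsym dtri] := d_metric.
move=> /multiplicative_cvg_dist cvx; apply/esym/deq/eqP.
rewrite eq_le d_ge1 andbT.
have cvxS : d (x_ n.+1) x @[n --> \oo] --> (1 : R).
  by rewrite (cvg_shiftS (fun n => d (x_ n) x)).
have cvb : d (x_ n.+1) x ^+ 2 * a_ n @[n --> \oo] --> (1 : R).
  rewrite -[X in _ --> X](mulr1 1) -{1}(mulr1 1).
  under eq_fun do rewrite expr2.
  by apply: cvgM orbit_step_cvg1; exact: cvgM.
apply: (ler_cvg_to (cvg_cst _) cvb); apply: nearW => n.
have d0 y z : 0 <= d y z by apply: le_trans (d_ge1 _ _).
have b0 : 0 < d x (T x) by apply: lt_le_trans (d_ge1 _ _).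
(* With [b = d x (T x)], the triangle inequality through [x_ n.+1] and the contraction give [b ^+ 2
   <= d (x_ n.+1) x ^+ 2 * (a_ n * b)]; one factor [b] cancels. *)
rewrite -(ler_pM2r b0) -expr2 -mulrA.
apply: le_trans (ler_wpM2l (sqr_ge0 _) (contraction_sqr_le (x_ n) x)).
by rewrite -exprMn lerXn2r ?nnegrE ?mulr_ge0// (dsym _ x).
Qed.

End FixedPoint.
End MultiplicativeContraction.

Theorem theorem3p7 (R : realType) (M : Type) (d : M -> M -> R)
  (d_space : multiplicative_metric_space d)
  (d_complete : multiplicative_complete d)
  (phi : R * R -> R)
  (phi_ge1 : forall x y : R, 1 <= x -> 1 <= y -> 1 <= phi (x, y))
  (phi_cont : {within [set p : R * R | 1 <= p.1 /\ 1 <= p.2], continuous phi})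
  (phi_eq1 : forall x y : R, 1 <= x -> 1 <= y ->
     (phi (x, y) = 1 <-> x = 1 /\ y = 1))
  (T : M -> M)
  (T_contr : forall u v : M,
     d (T u) (T v) <=
       ((d u (T u) * d v (T v)) `^ (1 / 2)) / phi (d u (T u), d v (T v))) :
  exists! u : M, T u = u.
Proof.
have [[x0 _] dm] := d_space; have [_ deq _ _] := dm.
have [x xx] :=
  d_complete _ (orbit_cauchy dm phi_ge1 phi_cont phi_eq1 T_contr x0).
have Tx := orbit_limit_fixed dm phi_ge1 phi_cont phi_eq1 T_contr xx.
exists x; split=> // y Ty; apply/deq/eqP.
have d1 u v : 1 <= d u v by case: dm.
(* At two fixed points both displacements are 1, so [d x y ^+ 2 <= 1], which forces [d x y = 1]. *)
have := contraction_sqr_le dm phi_ge1 T_contr x y.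
rewrite Tx Ty (deq x x).2// (deq y y).2// mulr1.
rewrite expr_le1 ?(le_trans ler01 (d1 _ _))// => h.
by rewrite eq_le h d1.
Qed.
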